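(* Consider the bilevel polynomial problem $(P)$ described in the context, and suppose that its lower level problem is convex. Suppose that the lower level problem satisfies both the nondegeneracy condition and the Slater condition. Then $(x,y)\in\mathbb{R}^n\times\mathbb{R}^m$ is a global solution of $(P)$ if and only if there exists $\lambda=(\lambda_0,\ldots,\lambda_r)\in\mathbb{R}^{r+1}$ such that $(x,y,\lambda)\in\mathbb{R}^n\times\mathbb{R}^m\times\mathbb{R}^{r+1}$ is a global solution of the single level polynomial optimization problem $$(\overline{P})\quad \min_{x\in\mathbb{R}^n,\,y\in\mathbb{R}^m,\,\lambda\in\mathbb{R}^{r+1}} f(x,y)$$ subject to $$g_i(x,y)\le 0,\ i=1,\ldots,s,$$ $$\lambda_0\nabla_y G(x,y)+\sum_{j=1}^r\lambda_j\nabla h_j(y)=0,$$ $$\lambda_0\ge 0,\quad \sum_{j=0}^r\lambda_j^2=1,\quad \lambda_jh_j(y)=0,\ \lambda_j\ge 0,\ h_j(y)\le 0,\ j=1,\ldots,r.$$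
   Context: The bilevel polynomial optimization problem is $$(P)\quad \min_{x\in\mathbb{R}^n,\,y\in\mathbb{R}^m} f(x,y)\ \text{ subject to }\ g_i(x,y)\le 0,\ i=1,\ldots,s,\quad y\in Y(x):=\mathrm{argmin}_{w\in\mathbb{R}^m}\{G(x,w): h_j(w)\le 0,\ j=1,\ldots,r\},$$ where $f,g_i,G:\mathbb{R}^n\times\mathbb{R}^m\to\mathbb{R}$ and $h_j:\mathbb{R}^m\to\mathbb{R}$ are polynomials with real coefficients. Standing assumption: the feasible set $\{(x,y): g_i(x,y)\le 0,\ i=1,\ldots,s,\ y\in Y(x)\}$ of $(P)$ is nonempty. The lower level problem is convex if for each $x\in\mathbb{R}^n$ the polynomial $G(x,\cdot)$ is convex on $\mathbb{R}^m$ and the set $F:=\{w\in\mathbb{R}^m: h_j(w)\le 0,\ j=1,\ldots,r\}$ is convex (the polynomials $h_j$ themselves need not be convex). Nondegeneracy condition: for each $j=1,\ldots,r$, if $y\in F$ and $h_j(y)=0$ then $\nabla h_j(y)\ne 0$. Slater condition: there exists $y_0\in\mathbb{R}^m$ with $h_j(y_0)<0$ for all $j=1,\ldots,r$. $\nabla_yG$ denotes the gradient of $G$ with respect to its second variable. A global solution is a feasible point attaining the minimum of the objective over the feasible set. *)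

(* Defs.v *)
From mathcomp Require Import all_boot all_order all_algebra.
From mathcomp Require Import mpoly.
From mathcomp Require Import classical_sets reals convex.

Set Implicit Arguments.
Unset Strict Implicit.
Unset Printing Implicit Defensive.

Import Order.TTheory GRing.Theory Num.Theory.

Local Open Scope classical_set_scope.
Local Open Scope ring_scope.

Definition global_solution (R : realType) (T : Type) (S : set T) (obj : T -> R)
    (z : T) : Prop :=
  S z /\ forall z', S z' -> obj z <= obj z'.

Definition peval (R : realType) (m : nat) (p : {mpoly R[m]}) (w : 'rV[R]_m) : R :=
  p.@[w 0].

(* A polynomial on R^n x R^m is an element of {mpoly R[n + m]}: the variables
   [lshift m i] are the coordinates of x, the variables [rshift n k] are those
   of y. *)
Definition peval2 (R : realType) (n m : nat) (p : {mpoly R[n + m]})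
    (x : 'rV[R]_n) (y : 'rV[R]_m) : R :=
  peval p (row_mx x y).

Definition grad (R : realType) (m : nat) (p : {mpoly R[m]}) (w : 'rV[R]_m) :
    'rV[R]_m :=
  \row_k peval (mderiv k p) w.

Definition grad_y (R : realType) (n m : nat) (p : {mpoly R[n + m]})
    (x : 'rV[R]_n) (y : 'rV[R]_m) : 'rV[R]_m :=
  \row_k peval2 (mderiv (rshift n k) p) x y.

Definition lower_feasible (R : realType) (m r : nat) (h : 'I_r -> {mpoly R[m]}) :
    set 'rV[R]_m :=
  [set w | forall j, peval (h j) w <= 0].

Definition lower_solutions (R : realType) (n m r : nat) (G : {mpoly R[n + m]})
    (h : 'I_r -> {mpoly R[m]}) (x : 'rV[R]_n) : set 'rV[R]_m :=
  [set y | global_solution (lower_feasible h) (peval2 G x) y].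

Definition bilevel_feasible (R : realType) (n m s r : nat)
    (g : 'I_s -> {mpoly R[n + m]}) (G : {mpoly R[n + m]})
    (h : 'I_r -> {mpoly R[m]}) : set ('rV[R]_n * 'rV[R]_m) :=
  [set z | (forall i, peval2 (g i) z.1 z.2 <= 0) /\ lower_solutions G h z.1 z.2].

Definition lower_convex (R : realType) (n m r : nat) (G : {mpoly R[n + m]})
    (h : 'I_r -> {mpoly R[m]}) : Prop :=
  (forall x : 'rV[R]_n, convex_function setT (peval2 G x)) /\
  convex_set (lower_feasible h).

Definition nondegeneracy_condition (R : realType) (m r : nat)
    (h : 'I_r -> {mpoly R[m]}) : Prop :=
  forall j y, lower_feasible h y -> peval (h j) y = 0 -> grad (h j) y <> 0.

Definition slater_condition (R : realType) (m r : nat)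
    (h : 'I_r -> {mpoly R[m]}) : Prop :=
  exists y0, forall j, peval (h j) y0 < 0.

(* The multiplier vector (lambda_0, ..., lambda_r) is [lam : 'rV_r.+1];
   lambda_0 is [lam 0 ord0], and the multiplier of the constraint [h j] (with
   [j : 'I_r] counted from 0) is [lam 0 (lift ord0 j)]. *)
Definition single_level_feasible (R : realType) (n m s r : nat)
    (g : 'I_s -> {mpoly R[n + m]}) (G : {mpoly R[n + m]})
    (h : 'I_r -> {mpoly R[m]}) : set ('rV[R]_n * 'rV[R]_m * 'rV[R]_r.+1) :=
  [set z : 'rV[R]_n * 'rV[R]_m * 'rV[R]_r.+1 |
    let: (x, y, lam) := z in
    [/\ forall i, peval2 (g i) x y <= 0,
        lam 0 ord0 *: grad_y G x y
          + \sum_(j < r) lam 0 (lift ord0 j) *: grad (h j) y = 0,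
        0 <= lam 0 ord0,
        \sum_(j < r.+1) lam 0 j ^+ 2 = 1
      & forall j : 'I_r,
          [/\ lam 0 (lift ord0 j) * peval (h j) y = 0,
              0 <= lam 0 (lift ord0 j)
            & peval (h j) y <= 0]]].

(* Main.v *)
Require Import Defs.
From mathcomp Require Import all_boot all_order all_algebra.
From mathcomp Require Import mpoly polyrcf.
From mathcomp Require Import classical_sets reals convex.
From mathcomp Require Import interval_inference ring lra.

Set Implicit Arguments.
Unset Strict Implicit.
Unset Printing Implicit Defensive.

Import Order.TTheory GRing.Theory Num.Theory.

Local Open Scope classical_set_scope.
Local Open Scope ring_scope.

(** The two problems have the same objective, so it suffices to see that the
    feasible set of the bilevel problem is the projection of the feasible set of
    the single level problem along the multipliers.  This amounts to a statement
    about the lower level problem at a fixed x: the point y minimizes G(x, .)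
    over F if and only if the Fritz John system of the single level problem has
    a solution lambda at (x, y).

    Necessity ([fritz_john_necessary]): a direction along which G(x, .) and all
    the active h_j have negative slope would lead from a minimizer y to a
    feasible point with a smaller value of G.  So no such direction exists, and
    Gordan's theorem of the alternative ([gordan]) yields nonnegative
    multipliers, not all zero, which are then scaled to Euclidean norm 1.

    For sufficiency, the crucial point is that lambda_0 > 0
    ([fritz_john_multiplier_gt0]). Since F is convex, the gradient of an active
    constraint makes a nonpositive product with w - y for every w in F
    ([active_grad_le0]). If lambda_0 were 0, these products, weighted by the
    lambda_j, would add up to 0, hence all vanish. A constraint with lambda_j >
    0 would then have a gradient orthogonal to w - y for all w in F; as the
    Slater point is interior to F, this gradient would be 0, against
    nondegeneracy. With lambda_0 > 0 the stationarity equation says that the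
    gradient of G(x, .) at y makes a nonnegative product with w - y for w in F,
    and the gradient inequality for the convex polynomial G(x, .) makes y a
    minimizer.

    All the analysis takes place on lines: along w + t d a polynomial in m
    variables becomes a univariate polynomial in t ([line_poly]), whose
    derivative at 0 is the product of the gradient with d. *)

(** * Properties that hold for all small positive reals *)

(** Finitely many conditions, each met for small enough steps along a direction,
    are met by a common step: this is how a strictly negative slope or a
    strictly satisfied constraint is turned into an actual point. *)
Definition near0 (R : realFieldType) (P : R -> Prop) : Prop :=
  exists2 e, 0 < e & forall t, 0 < t -> t < e -> P t.

Lemma near0_le1 (R : realFieldType) (P : R -> Prop) :
  near0 P -> exists t, [/\ 0 < t, t <= 1 & P t].
Proof.
move=> [e e_gt0 eP]; have [e1|e1] := ltP 1 e.
  by exists 1; split=> //; exact: eP.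
by exists (e / 2); split; [lra | lra | apply: eP; lra].
Qed.

Lemma near0_and (R : realFieldType) (P Q : R -> Prop) :
  near0 P -> near0 Q -> near0 (fun t => P t /\ Q t).
Proof.
move=> [e e_gt0 eP] [e' e'_gt0 e'Q].
exists (Num.min e e'); first by rewrite lt_min e_gt0.
move=> t t_gt0; rewrite lt_min => /andP[te te'].
by split; [exact: eP | exact: e'Q].
Qed.

Lemma near0_forall (R : realFieldType) (k : nat) (P : 'I_k -> R -> Prop) :
  (forall i, near0 (P i)) -> near0 (fun t => forall i, P i t).
Proof.
elim: k P => [|k IHk] P nP; first by exists 1 => // t _ _ [].
have [|e e_gt0 eP] := near0_and (nP ord0) (IHk (fun i => P (lift ord0 i)) _).
  by move=> i; exact: nP.
exists e => // t t_gt0 te i; have [P0 PS] := eP t t_gt0 te.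
by case: (unliftP ord0 i) => [j|] ->.
Qed.

Lemma near0_affine_lt0 (R : realFieldType) (u v : R) :
  u < 0 -> near0 (fun t => u + t * v < 0).
Proof.
move=> u_lt0; have v1 : 0 < `|v| + 1 by have := normr_ge0 v; lra.
exists (- u / (`|v| + 1)); first by rewrite divr_gt0 ?oppr_gt0.
move=> t t_gt0; rewrite ltr_pdivlMr// => tu.
by have := ler_wpM2l (ltW t_gt0) (ler_norm v); lra.
Qed.

Lemma near0_horner_lt0 (R : rcfType) (p : {poly R}) :
  p.[0] < 0 -> near0 (fun t => p.[t] < 0).
Proof.
move=> p0; have [|e e_gt0 eP] := @poly_cont R 0 p (- p.[0]).
  by rewrite oppr_gt0.
exists e => // t t_gt0 te; have := eP t; rewrite subr0 gtr0_norm// => /(_ te).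
by rewrite ltr_norml; lra.
Qed.

(** As p(0) = 0, p is t q(t) with q(0) = p'(0), and q stays negative near 0 by
    continuity. *)
Lemma near0_horner_deriv_lt0 (R : rcfType) (p : {poly R}) :
  p.[0] = 0 -> p^`().[0] < 0 -> near0 (fun t => p.[t] < 0).
Proof.
move=> /eqP/factor_theorem[q ->]; rewrite subr0 derivM derivX mulr1 hornerD.
rewrite hornerMX mulr0 add0r => /near0_horner_lt0[e e_gt0 eP].
by exists e => // t t_gt0 te; rewrite hornerMX pmulr_llt0// eP.
Qed.

(** * The scalar product of row vectors *)

Section Dot.
Variables (R : realFieldType) (m : nat).
Implicit Types u v w : 'rV[R]_m.

Definition dot u v : R := \sum_k u 0 k * v 0 k.

Lemma dotDl u v w : dot (u + v) w = dot u w + dot v w.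
Proof. by rewrite -big_split; apply: eq_bigr => k _; rewrite mxE mulrDl. Qed.

Lemma dotDr u v w : dot u (v + w) = dot u v + dot u w.
Proof. by rewrite -big_split; apply: eq_bigr => k _; rewrite mxE mulrDr. Qed.

Lemma dotZl c u v : dot (c *: u) v = c * dot u v.
Proof. by rewrite mulr_sumr; apply: eq_bigr => k _; rewrite mxE mulrA. Qed.

Lemma dotZr c u v : dot u (c *: v) = c * dot u v.
Proof. by rewrite mulr_sumr; apply: eq_bigr => k _; rewrite mxE mulrCA. Qed.

Lemma dot0l v : dot 0 v = 0.
Proof. by rewrite -(scale0r v) dotZl mul0r. Qed.

Lemma dot_suml k (a : 'I_k -> 'rV[R]_m) v :
  dot (\sum_i a i) v = \sum_i dot (a i) v.
Proof.
by elim/big_ind2: _ => [|x1 x2 y1 y2 <- <-|//]; rewrite ?dot0l ?dotDl.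
Qed.

Lemma dot_gt0 u : u != 0 -> 0 < dot u u.
Proof.
move=> u0; have uu0 i : 0 <= u 0 i * u 0 i by rewrite -expr2 sqr_ge0.
rewrite lt_neqAle sumr_ge0 ?andbT// eq_sym; apply: contraNN u0 => /eqP uu.
apply/eqP/rowP => i; rewrite mxE; apply/eqP; rewrite -[_ == _]orbb -mulf_eq0.
by have /psumr_eq0P/(_ i isT)/eqP := uu; apply => // j _.
Qed.

End Dot.

Lemma dot_row_mx (R : realFieldType) (m1 m2 : nat)
    (u1 v1 : 'rV[R]_m1) (u2 v2 : 'rV[R]_m2) :
  dot (row_mx u1 u2) (row_mx v1 v2) = dot u1 v1 + dot u2 v2.
Proof.
rewrite /dot big_split_ord /=; congr (_ + _); apply: eq_bigr => k _.
  by rewrite !row_mxEl.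
by rewrite !row_mxEr.
Qed.

(** * Gordan's theorem of the alternative *)

(** The last step of the induction in Gordan's theorem: d is moved slightly
    against b, which makes the product with b negative and, the a i being
    finitely many, leaves the other products negative. *)
Lemma perturb_orthogonal (R : realFieldType) (k m : nat)
    (a : 'I_k -> 'rV[R]_m) (b d : 'rV[R]_m) :
    b != 0 -> dot b d = 0 -> (forall i, dot (a i) d < 0) ->
  exists d', dot b d' < 0 /\ forall i, dot (a i) d' < 0.
Proof.
move=> b0 bd ad.
have [|t [t_gt0 _ at_lt0]] := @near0_le1 R (fun t =>
    forall i, dot (a i) d + t * - dot (a i) b < 0).
  by apply: near0_forall => i; exact: near0_affine_lt0.
have dotE u : dot u (d - t *: b) = dot u d + t * - dot u b.
  by rewrite dotDr -scaleNr dotZr mulNr mulrN.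
exists (d - t *: b); split=> [|i]; rewrite dotE//.
by rewrite bd add0r mulrN oppr_lt0 mulr_gt0 ?dot_gt0.
Qed.

(** Gordan's theorem of the alternative, by induction on the number of vectors.
    Given d for all the vectors but b, the only difficult case is dot b d > 0.
    The other vectors are then projected along b onto the hyperplane orthogonal
    to d, which adds to them positive multiples of b.  If the projections admit
    multipliers, so do the vectors together with b.  If they are all negative on
    some d', then d' corrected by a multiple of d is orthogonal to b and
    negative on the other vectors, and it remains to perturb it. *)
Lemma gordan (R : realFieldType) (k m : nat) (a : 'I_k -> 'rV[R]_m) :
  (exists d, forall i, dot (a i) d < 0) \/
  exists c : 'I_k -> R,
    [/\ forall i, 0 <= c i, exists i, 0 < c i & \sum_i c i *: a i = 0].
Proof.
elim: k a => [|k IHk] a; first by left; exists 0 => -[].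
set b := a ord0; pose a' i := a (lift ord0 i).
have ordP d : dot b d < 0 /\ (forall i, dot (a' i) d < 0) ->
    forall i, dot (a i) d < 0.
  move=> [bd ad] i.
  by case: (unliftP ord0 i) => [j|] ->; [exact: ad | exact: bd].
have extend c0 (c : 'I_k -> R) : 0 <= c0 -> (forall i, 0 <= c i) ->
    0 < c0 \/ (exists i, 0 < c i) -> c0 *: b + \sum_i c i *: a' i = 0 ->
    exists c : 'I_k.+1 -> R,
    [/\ forall i, 0 <= c i, exists i, 0 < c i & \sum_i c i *: a i = 0].
  move=> c0_ge0 c_ge0 c_gt0 sum0.
  exists (fun i => oapp c c0 (unlift ord0 i)); split.
  - by move=> i; case: unliftP => [j|] _; [exact: c_ge0 | exact: c0_ge0].
  - case: c_gt0 => [?|[i ?]]; first by exists ord0; rewrite unlift_none.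
    by exists (lift ord0 i); rewrite liftK.
  - rewrite big_ord_recl unlift_none -[RHS]sum0; congr (_ + _).
    by apply: eq_bigr => i _; rewrite liftK.
have [[d ad]|[c [c_ge0 c_gt0 sum0]]] := IHk a'; last first.
  by right; apply: (extend 0 c) => //; [right | rewrite scale0r add0r].
have [bd|bd] := ltP (dot b d) 0; first by left; exists d; exact: ordP.
have [b0|b0] := eqVneq b 0.
  right; apply: (extend 1 (fun=> 0)) => //; first by left.
  by rewrite b0 scaler0 add0r big1// => i _; rewrite scale0r.
have [bd0|bd0] := eqVneq (dot b d) 0.
  by have [d' /ordP] := perturb_orthogonal b0 bd0 ad; left; exists d'.
have bd_gt0 : 0 < dot b d by rewrite lt_neqAle eq_sym bd0.
pose e i := - dot (a' i) d / dot b d.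
have e_gt0 i : 0 < e i by rewrite divr_gt0 ?oppr_gt0.
have [[d' ad']|[c [c_ge0 [i ci_gt0] sum0]]] := IHk (fun i => a' i + e i *: b).
  (* d'' is d' projected along d onto the orthogonal of b; the products with
     the a' i + e i *: b are unchanged, as these are orthogonal to d. *)
  pose d'' := d' - (dot b d' / dot b d) *: d.
  have [||d3 /ordP] := @perturb_orthogonal R k m a' b d'' b0.
  - by rewrite dotDr -scaleNr dotZr mulNr divfK ?subrr.
  - move=> i; have := ad' i; rewrite /d'' dotDr -scaleNr dotZr dotDl dotZl /e.
    suff -> : - dot (a' i) d / dot b d * dot b d' =
      - (dot b d' / dot b d) * dot (a' i) d by [].
    by field.
  by left; exists d3.
right; apply: (extend (\sum_i c i * e i) c) => //; last 2 first.
- by right; exists i.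
- rewrite scaler_suml addrC -big_split -[RHS]sum0; apply: eq_bigr => j _ /=.
  by rewrite scalerDr scalerA.
- by apply: sumr_ge0 => j _; rewrite mulr_ge0// ltW.
Qed.

(** * Polynomials along a line *)

Section LinePolynomial.
Variables (R : realType) (m : nat).
Implicit Types (p q : {mpoly R[m]}) (w d : 'rV[R]_m).

Definition line_poly w d p : {poly R} :=
  mmap polyC (fun k => (w 0 k)%:P + d 0 k *: 'X) p.

Lemma line_polyE w d p t : (line_poly w d p).[t] = peval p (w + t *: d).
Proof.
rewrite /line_poly /peval mevalE /mmap horner_sum; apply: eq_bigr => i _.
rewrite hornerM hornerC /mmap1 horner_prod; congr (_ * _).
apply: eq_bigr => k _; rewrite horner_exp; congr (_ ^+ _).
by rewrite hornerD hornerC hornerZ hornerX !mxE mulrC.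
Qed.

(** The chain rule.  Both sides are derivations on polynomials over evaluation
    at w, so that it is enough to check constants and variables. *)
Lemma deriv_line_poly w d p : (line_poly w d p)^`().[0] = dot (grad p w) d.
Proof.
have L0 q : (line_poly w d q).[0] = q.@[w 0].
  by rewrite line_polyE scale0r addr0.
suff: (line_poly w d p)^`().[0] = \sum_k (mderiv k p).@[w 0] * d 0 k.
  by move=> ->; apply: eq_bigr => k _; rewrite mxE.
pose P q := (line_poly w d q)^`().[0] = \sum_k (mderiv k q).@[w 0] * d 0 k.
have PC c : P c%:MP.
  rewrite /P /line_poly mmapC derivC horner0 big1// => k _.
  by rewrite mderivC meval0 mul0r.
have PM q1 q2 : P q1 -> P q2 -> P (q1 * q2).
  rewrite /P /line_poly rmorphM derivM hornerD !hornerM -!/(line_poly _ _ _).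
  rewrite !L0 => -> ->; rewrite mulr_suml mulr_sumr -big_split.
  apply: eq_bigr => k _ /=; rewrite mderivM mevalD !mevalM; ring.
have PX i : P 'X_i.
  rewrite /P /line_poly mmapX mmap1U derivD derivC add0r derivZ derivX.
  rewrite hornerZ hornerC mulr1 (bigD1 i)//= big1 => [|k ki].
    rewrite mderivX mnm1E eqxx scale1r -{1}[U_(i)%MM]add0m addmK.
    by rewrite mpolyX0 meval1 mul1r addr0.
  by rewrite mderivX mnm1E eq_sym (negbTE ki) scale0r meval0 mul0r.
rewrite -/(P p); elim/mpolyind: p => [|c M q _ _ Pq]; first exact: PC 0.
have PXM : P 'X_[M].
  rewrite mpolyXE_id; elim/big_ind: _ => [|//|i _]; first exact: PC 1.
  by elim: (M i) => [|l IHl]; [exact: PC 1 | rewrite exprS; exact: PM].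
have : P (c *: 'X_[M]) by rewrite -mul_mpolyC; exact: PM.
move: Pq; rewrite /P /line_poly mmapD derivD hornerD => -> ->.
rewrite -big_split; apply: eq_bigr => k _ /=.
by rewrite mderivD mevalD mulrDl addrC.
Qed.

End LinePolynomial.

Section Directional.
Variables (R : realType) (m : nat).
Implicit Types (p : {mpoly R[m]}) (w d : 'rV[R]_m).

Lemma near0_peval_lt0 p w d :
  peval p w < 0 -> near0 (fun t => peval p (w + t *: d) < 0).
Proof.
move=> pw; have [|e e_gt0 eP] := @near0_horner_lt0 R (line_poly w d p).
  by rewrite line_polyE scale0r addr0.
by exists e => // t t_gt0 te; rewrite -line_polyE; exact: eP.
Qed.

Lemma near0_peval_descent p w d :
  dot (grad p w) d < 0 -> near0 (fun t => peval p (w + t *: d) < peval p w).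
Proof.
move=> pd; have [||e e_gt0 eP] :=
    @near0_horner_deriv_lt0 R (line_poly w d p - (peval p w)%:P).
- by rewrite hornerD hornerN hornerC line_polyE scale0r addr0 subrr.
- by rewrite derivB derivC subr0 deriv_line_poly.
exists e => // t t_gt0 te; rewrite -subr_lt0 -line_polyE.
by have := eP t t_gt0 te; rewrite hornerD hornerN hornerC.
Qed.

(** Convexity enters through this inequality, in two ways: c = p(w + d) - p(w)
    gives the gradient inequality of a convex objective, while c = 0 serves
    for a constraint active at w, which stays nonpositive on any segment from
    w to another point of the convex feasible set. If the slope at 0 exceeded
    c, then p(w) + t c - p(w + t d), which vanishes at 0, would be negative
    for small t. *)
Lemma grad_le_slope p w d (c : R) :
  (forall t, 0 < t -> t <= 1 -> peval p (w + t *: d) <= peval p w + t * c) ->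
  dot (grad p w) d <= c.
Proof.
move=> le_c; rewrite leNgt; apply/negP => c_lt.
have [||t [t_gt0 t_le1]] := near0_le1 (@near0_horner_deriv_lt0 R
    ((peval p w)%:P + c *: 'X - line_poly w d p) _ _).
- by rewrite !hornerE line_polyE scale0r addr0 subrr.
- rewrite derivB derivD derivC derivZ derivX add0r !hornerE deriv_line_poly.
  by rewrite subr_lt0.
rewrite !hornerE line_polyE mulrC; apply/negP; rewrite -leNgt subr_ge0.
exact: le_c.
Qed.

End Directional.

(** The gradient in y of G is the second half of the full gradient, that is, the
    gradient along the directions (0, d). *)
Section PartialGradient.
Variables (R : realType) (n m : nat) (G : {mpoly R[n + m]}).
Variables (x : 'rV[R]_n) (y d : 'rV[R]_m).

Let peval2_line t :
  peval2 G x (y + t *: d) = peval G (row_mx x y + t *: row_mx 0 d).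
Proof. by rewrite scale_row_mx add_row_mx scaler0 addr0. Qed.

Let dot_grad_y :
  dot (grad G (row_mx x y)) (row_mx 0 d) = dot (grad_y G x y) d.
Proof.
rewrite -[grad _ _]hsubmxK dot_row_mx /dot [X in X + _]big1 => [|k _].
  by rewrite add0r; apply: eq_bigr => k _; rewrite !mxE.
by rewrite [X in _ * X]mxE mulr0.
Qed.

Lemma near0_peval2_descent : dot (grad_y G x y) d < 0 ->
  near0 (fun t => peval2 G x (y + t *: d) < peval2 G x y).
Proof.
rewrite -dot_grad_y => /near0_peval_descent[e e_gt0 eP].
by exists e => // t t_gt0 te; rewrite peval2_line; exact: eP.
Qed.

Lemma grad_y_le_slope (c : R) :
  (forall t, 0 < t -> t <= 1 ->
     peval2 G x (y + t *: d) <= peval2 G x y + t * c) ->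
  dot (grad_y G x y) d <= c.
Proof.
move=> le_c; rewrite -dot_grad_y; apply: grad_le_slope => t t_gt0 t_le1.
by rewrite -peval2_line; exact: le_c.
Qed.

End PartialGradient.

Lemma conv_segment (R : realType) (m : nat) (y w : 'rV[R]_m) (t : R) :
  0 < t -> t <= 1 ->
  exists2 l : {i01 R}, l%:num = t &
    y + t *: (w - y) = conv l (w : convex_lmodType 'rV[R]_m) y.
Proof.
move=> t_gt0 t_le1; exists (Itv01 (ltW t_gt0) t_le1) => //.
by rewrite /conv /= /unstable.onem scalerBl scale1r scalerBr addrCA.
Qed.

(** * Fritz John conditions for the lower level problem *)

Section LowerLevel.
Variables (R : realType) (n m r : nat).
Variables (G : {mpoly R[n + m]}) (h : 'I_r -> {mpoly R[m]}).

Definition fritz_john (x : 'rV[R]_n) (y : 'rV[R]_m) (lam : 'rV[R]_r.+1) :=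
  [/\ lam 0 ord0 *: grad_y G x y
        + \sum_(j < r) lam 0 (lift ord0 j) *: grad (h j) y = 0,
      0 <= lam 0 ord0,
      \sum_(j < r.+1) lam 0 j ^+ 2 = 1
    & forall j : 'I_r,
        [/\ lam 0 (lift ord0 j) * peval (h j) y = 0,
            0 <= lam 0 (lift ord0 j)
          & peval (h j) y <= 0]].

(** Gordan's theorem is applied to the vectors (grad_y G, 0) and
    (grad h_j, h_j(y)).  The extra coordinate takes care of complementarity:
    it is 0 for the active constraints, so a direction that is negative on all
    the vectors is a descent direction for G and these constraints, whereas for
    multipliers it gives \sum_j c_j h_j(y) = 0, a sum of nonpositive terms. *)
Lemma fritz_john_necessary x y :
  lower_solutions G h x y -> exists lam, fritz_john x y lam.
Proof.
move=> [y_feas y_min].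
pose a (i : 'I_r.+1) : 'rV[R]_(m + 1) :=
  oapp (fun j => row_mx (grad (h j) y) (peval (h j) y)%:M)
       (row_mx (grad_y G x y) 0) (unlift ord0 i).
have [[d ad]|[c [c_ge0 [i0 ci0] sum0]]] := gordan a.
  exfalso; pose v := lsubmx d; pose tau := rsubmx d 0 0.
  have dotE b e : dot (row_mx b e%:M) d = dot b v + e * tau.
    rewrite -[in LHS](hsubmxK d) dot_row_mx; congr (_ + _).
    by rewrite /dot big_ord1 mxE eqxx mulr1n.
  have Gv : dot (grad_y G x y) v < 0.
    have := ad ord0; rewrite /a unlift_none /=.
    by rewrite -(raddf0 (@scalar_mx R 1)) dotE mul0r addr0.
  have hv j : near0 (fun t => peval (h j) (y + t *: v) < 0).
    have [hj|hj] := ltP (peval (h j) y) 0; first exact: near0_peval_lt0.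
    have hj0 : peval (h j) y = 0 by apply: le_anti; rewrite hj y_feas.
    have := ad (lift ord0 j); rewrite /a liftK /= dotE hj0 mul0r addr0.
    by move=> /near0_peval_descent; rewrite hj0.
  have [t [_ _ [Gt ht]]] :=
    near0_le1 (near0_and (near0_peval2_descent Gv) (near0_forall hv)).
  suff /y_min : lower_feasible h (y + t *: v) by rewrite leNgt Gt.
  by move=> j; exact: ltW.
have [sumG sumh] : c ord0 *: grad_y G x y
        + \sum_(j < r) c (lift ord0 j) *: grad (h j) y = 0 /\
      \sum_(j < r) c (lift ord0 j) * peval (h j) y = 0.
  move: sum0; rewrite big_ord_recl /a unlift_none /=.
  under eq_bigr do rewrite liftK /=.
  move=> sum0; split.
    have := congr1 lsubmx sum0; rewrite linearD linearZ linear_sum /=.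
    rewrite row_mxKl linear0 => sumG; rewrite -[RHS]sumG; congr (_ + _).
    by apply: eq_bigr => j _; rewrite linearZ /= row_mxKl.
  have := congr1 (fun M => rsubmx M 0 0) sum0.
  rewrite linearD linearZ linear_sum /= row_mxKr scaler0 linear0 add0r.
  rewrite summxE [X in _ = X -> _]mxE => sum0'.
  rewrite -[RHS]sum0'; apply: eq_bigr => j _.
  by rewrite linearZ /= row_mxKr !mxE eqxx mulr1n.
have compl j : c (lift ord0 j) * peval (h j) y = 0.
  have term_ge0 i : 0 <= - (c (lift ord0 i) * peval (h i) y).
    by rewrite oppr_ge0 mulr_ge0_le0.
  have /psumr_eq0P/(_ j isT)/eqP :
      \sum_i - (c (lift ord0 i) * peval (h i) y) = 0.
    by rewrite sumrN sumh oppr0.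
  by rewrite oppr_eq0 => H; apply/eqP/H.
pose N := \sum_i c i ^+ 2.
have N_gt0 : 0 < N.
  rewrite /N (bigD1 i0)//= ltr_wpDr ?exprn_gt0//.
  by apply: sumr_ge0 => i _; exact: sqr_ge0.
pose k := (Num.sqrt N)^-1; have k_ge0 : 0 <= k by rewrite invr_ge0 sqrtr_ge0.
exists (\row_i (k * c i)); split.
- rewrite mxE -scalerA; under eq_bigr do rewrite mxE -scalerA.
  by rewrite -scaler_sumr -scalerDr sumG scaler0.
- by rewrite mxE mulr_ge0.
- under eq_bigr do rewrite mxE exprMn.
  by rewrite -mulr_sumr -/N exprVn sqr_sqrtr ?mulVf ?gt_eqF// ltW.
- by move=> j; rewrite mxE -mulrA compl mulr0 mulr_ge0.
Qed.

Hypothesis convex_lower : lower_convex G h.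
Hypothesis h_nondegenerate : nondegeneracy_condition h.
Hypothesis h_slater : slater_condition h.

Lemma active_grad_le0 j y w : lower_feasible h y -> lower_feasible h w ->
  peval (h j) y = 0 -> dot (grad (h j) y) (w - y) <= 0.
Proof.
move=> y_feas w_feas hj0; apply: grad_le_slope => t t_gt0 t_le1.
have [l _ ->] := conv_segment y w t_gt0 t_le1; rewrite hj0 mulr0 addr0.
suff : conv l (w : convex_lmodType 'rV[R]_m) y \in lower_feasible h.
  by rewrite inE; apply.
by apply: convex_lower.2; rewrite inE.
Qed.

Lemma grad_y_le x y w :
  dot (grad_y G x y) (w - y) <= peval2 G x w - peval2 G x y.
Proof.
apply: grad_y_le_slope => t t_gt0 t_le1.
have [l lE ->] := conv_segment y w t_gt0 t_le1.
have := convex_lower.1 x l w y; rewrite !inE => /(_ I I)/le_trans; apply.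
rewrite convRE lE /unstable.onem; lra.
Qed.

(** With lambda_0 = 0, a constraint j with lambda_j > 0 would be active with a
    gradient u orthogonal to w - y for every w in F.  Both the Slater point y0
    and y0 + t u, for small t > 0, lie in F, which forces dot u u = 0. *)
Lemma fritz_john_multiplier_gt0 x y lam : fritz_john x y lam -> 0 < lam 0 ord0.
Proof.
move=> [stat lam0_ge0 norm1 lamP].
rewrite lt_neqAle lam0_ge0 andbT eq_sym; apply/eqP => lam0.
have y_feas : lower_feasible h y by move=> j; case: (lamP j).
have [y0 y0P] := h_slater.
have terms0 w : lower_feasible h w -> forall j,
    lam 0 (lift ord0 j) * dot (grad (h j) y) (w - y) = 0.
  move=> w_feas.
  have term_ge0 j : 0 <= - (lam 0 (lift ord0 j) * dot (grad (h j) y) (w - y)).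
    have [+ lamj_ge0 _] := lamP j; move/eqP; rewrite mulf_eq0.
    case/orP => [/eqP ->|/eqP hj0]; first by rewrite mul0r oppr0.
    by rewrite oppr_ge0 mulr_ge0_le0// active_grad_le0.
  move=> j; apply/eqP; rewrite -oppr_eq0; apply/eqP.
  have /psumr_eq0P :
      \sum_j - (lam 0 (lift ord0 j) * dot (grad (h j) y) (w - y)) = 0.
    have := congr1 (fun u => dot u (w - y)) stat.
    rewrite lam0 scale0r add0r dot0l dot_suml => sum0.
    rewrite sumrN; under eq_bigr do rewrite -dotZl.
    by rewrite sum0 oppr0.
  by apply.
have [j lamj] : exists j : 'I_r, lam 0 (lift ord0 j) != 0.
  apply/existsP; apply: contraPT norm1 => /existsPn lam0'.
  rewrite big_ord_recl lam0 expr0n big1 ?addr0 => [/esym/eqP|i _].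
    by rewrite oner_eq0.
  by have := lam0' i; rewrite negbK => /eqP ->; rewrite expr0n.
have hj0 : peval (h j) y = 0.
  by have [/eqP + _ _] := lamP j; rewrite mulf_eq0 (negbTE lamj) => /eqP.
pose u := grad (h j) y.
have [|t [t_gt0 _ y0t]] := @near0_le1 R (fun t =>
    forall i, peval (h i) (y0 + t *: u) < 0).
  by apply: near0_forall => i; exact: near0_peval_lt0.
have orth w : lower_feasible h w -> dot u (w - y) = 0.
  by move=> /terms0/(_ j)/eqP; rewrite mulf_eq0 (negbTE lamj) => /eqP.
have /eqP : dot u (y0 + t *: u - y) = 0 by apply: orth => i; exact: ltW.
rewrite addrAC dotDr orth ?add0r; last by move=> i; exact: ltW.
rewrite dotZr mulf_eq0 gt_eqF//= => /negPn/negP; apply.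
rewrite gt_eqF// dot_gt0//; apply/eqP; exact: h_nondegenerate.
Qed.

Lemma fritz_john_sufficient x y lam :
  fritz_john x y lam -> lower_solutions G h x y.
Proof.
move=> FJ; have lam0_gt0 := fritz_john_multiplier_gt0 FJ.
have [stat _ _ lamP] := FJ.
have y_feas : lower_feasible h y by move=> j; case: (lamP j).
split=> // w w_feas; rewrite -subr_ge0; apply: le_trans (grad_y_le x y w).
rewrite -(pmulr_rge0 _ lam0_gt0).
have := congr1 (fun u => dot u (w - y)) stat.
rewrite dotDl dotZl dot_suml dot0l => /eqP; rewrite addr_eq0 => /eqP ->.
rewrite oppr_ge0; apply: sumr_le0 => j _; rewrite dotZl.
have [+ lamj_ge0 _] := lamP j; move/eqP; rewrite mulf_eq0.
case/orP => [/eqP ->|/eqP hj0]; first by rewrite mul0r.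
by rewrite mulr_ge0_le0// active_grad_le0.
Qed.

End LowerLevel.

(** * Equivalence of the bilevel and single level problems *)

Lemma bilevel_feasibleE (R : realType) (n m s r : nat)
    (g : 'I_s -> {mpoly R[n + m]}) (G : {mpoly R[n + m]})
    (h : 'I_r -> {mpoly R[m]}) (convex_lower : lower_convex G h)
    (h_nondegenerate : nondegeneracy_condition h)
    (h_slater : slater_condition h) x y :
  bilevel_feasible g G h (x, y) <->
  exists lam, single_level_feasible g G h (x, y, lam).
Proof.
split=> [[/= gP /fritz_john_necessary[lam [? ? ? ?]]]|[lam [gP st l0 nm lP]]].
  by exists lam; split.
split=> //=.
by apply: (fritz_john_sufficient convex_lower h_nondegenerate h_slater
  (And4 st l0 nm lP)).
Qed.

Theorem proposition3p2 (R : realType) (n m s r : nat)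
    (f : {mpoly R[n + m]}) (g : 'I_s -> {mpoly R[n + m]})
    (G : {mpoly R[n + m]}) (h : 'I_r -> {mpoly R[m]})
    (feasible_nonempty : bilevel_feasible g G h !=set0)
    (convex_lower : lower_convex G h)
    (h_nondegenerate : nondegeneracy_condition h)
    (h_slater : slater_condition h)
    (x : 'rV[R]_n) (y : 'rV[R]_m) :
  global_solution (bilevel_feasible g G h) (fun z => peval2 f z.1 z.2) (x, y)
  <->
  exists lam : 'rV[R]_r.+1,
    global_solution (single_level_feasible g G h)
      (fun z => peval2 f z.1.1 z.1.2) (x, y, lam).
Proof.
have proj x' y' :=
  bilevel_feasibleE g convex_lower h_nondegenerate h_slater x' y'.
split=> [[/proj[lam xyF] xy_min]|[lam [xyF xy_min]]].
  exists lam; split=> // -[[x' y'] lam'] F'.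
  by apply: (xy_min (x', y')); apply/proj; exists lam'.
split=> [|[x' y'] /proj[lam' F']]; first by apply/proj; exists lam.
exact: xy_min F'.
Qed.
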